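(* Let $\mathcal{M}'$ be the class of all positive contractions $T$ on $\ell_2$ such that: (1) $\|T\|=1$; and (2) there exists a family $(u_r)_{r\in J}$ of norming vectors for $T$, indexed by a set $J\subseteq\mathbb{Z}_+$, such that $u_r\ge 0$ and $\|u_r\|=1$ for every $r\in J$, and $\bigcup_{r\in J}\mathrm{Supp}(u_r)=\mathbb{Z}_+$. Then every operator in $\mathcal{M}'$ is a point of continuity of the identity map $(\mathcal{P}_1(\ell_2),\mathrm{WOT})\to(\mathcal{P}_1(\ell_2),\mathrm{SOT})$.
   Context: $\ell_2=\ell_2(\mathbb{Z}_+)$ is the complex sequence space, $\mathbb{Z}_+=\{0,1,2,\dots\}$, with canonical basis $(e_n)_{n\ge 0}$. A vector $x=\sum_n x_n e_n$ is positive ($x\ge 0$) if $x_n\ge 0$ for all $n$; a bounded operator $T$ on $\ell_2$ is positive if $Tx\ge 0$ whenever $x\ge 0$; a positive contraction is a positive operator $T$ with $\|T\|\le 1$, and $\mathcal{P}_1(\ell_2)$ is the set of all positive contractions. For a vector $u$, $\mathrm{Supp}(u)=\{j\ge 0:\langle e_j,u\rangle\ne 0\}$. A vector $x\neq 0$ is norming for an operator $S$ if $\|Sx\|=\|S\|\,\|x\|$. The topologies on $\mathcal{P}_1(\ell_2)$ are: WOT: $T_i\to T$ iff $\langle y,T_ix\rangle\to\langle y,Tx\rangle$ for all $x,y$; SOT: $T_i\to T$ iff $\|T_ix-Tx\|\to 0$ for all $x$. *)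

(* Defs.v *)
From HB Require Import structures.
From mathcomp Require Import all_boot all_order all_algebra.
From mathcomp Require Import all_classical all_reals all_analysis.
From mathcomp Require Import complex ring.

Set Implicit Arguments.
Unset Strict Implicit.
Unset Printing Implicit Defensive.

Import Order.TTheory GRing.Theory Num.Theory.
Import numFieldNormedType.Exports.
Import ComplexField.Normc.

Local Open Scope classical_set_scope.
Local Open Scope ring_scope.

HB.instance Definition _ (R : rcfType) := NormedModule.copy R[i] (R[i]^o).

Section square_summable.
Variable R : realType.
Implicit Types x y : nat -> R[i].

Definition sqsum x : R^nat := series (fun n => normc (x n) ^+ 2).

Definition square_summable : {pred nat -> R[i]} :=
  [pred x | `[< cvgn (sqsum x) >]].

Lemma square_summableP x : x \in square_summable <-> cvgn (sqsum x).
Proof. by split=> [/asboolP|?]; last exact/asboolP. Qed.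

Lemma normc_ge0 (z : R[i]) : 0 <= normc z.
Proof. by case: z => a b; exact: sqrtr_ge0. Qed.

Lemma nondecreasing_sqsum x : nondecreasing_seq (sqsum x).
Proof.
apply/nondecreasing_seqP => n.
by rewrite /sqsum !seriesEnat /= big_nat_recr//= lerDl sqr_ge0.
Qed.

Lemma sqsum_ge0 x n : 0 <= sqsum x n.
Proof. by rewrite /sqsum seriesEnat /=; apply: sumr_ge0 => i _; exact: sqr_ge0. Qed.

Lemma cvg_sqsum_bound x (M : R) : (forall n, sqsum x n <= M) -> cvgn (sqsum x).
Proof.
move=> xM; apply: nondecreasing_is_cvgn; first exact: nondecreasing_sqsum.
by exists M => _ [n _ <-].
Qed.

Lemma sqsum_le_lim x n : cvgn (sqsum x) -> sqsum x n <= limn (sqsum x).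
Proof. by move=> cx; apply: nondecreasing_cvgn_le => //; exact: nondecreasing_sqsum. Qed.

Lemma lim_sqsum_le x (M : R) :
  (forall n, sqsum x n <= M) -> limn (sqsum x) <= M.
Proof.
move=> xM; apply: limr_le; first exact: cvg_sqsum_bound xM.
exact: nearW.
Qed.

Lemma lim_sqsum_ge0 x : cvgn (sqsum x) -> 0 <= limn (sqsum x).
Proof. by move=> cx; exact: le_trans (sqsum_ge0 x 0) (sqsum_le_lim 0 cx). Qed.

Lemma sqsum_term_le x n : cvgn (sqsum x) -> normc (x n) ^+ 2 <= limn (sqsum x).
Proof.
move=> cx; apply: le_trans (sqsum_le_lim n.+1 cx).
by rewrite /sqsum seriesEnat /= big_nat_recr//= lerDr; apply: sumr_ge0 => i _; exact: sqr_ge0.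
Qed.

Lemma le_normc_add (z w : R[i]) : normc (z + w) <= normc z + normc w.
Proof. exact: le_normcD. Qed.

(* (a + b)^2 <= (A + B) (a^2 / A + b^2 / B) holds termwise; summing it gives
   Minkowski's inequality. *)
Lemma sqsumD_le x y (A B : R) : 0 < A -> 0 < B ->
  (forall n, sqsum x n <= A ^+ 2) -> (forall n, sqsum y n <= B ^+ 2) ->
  forall n, sqsum (x + y) n <= (A + B) ^+ 2.
Proof.
move=> A0 B0 xA yB n.
have AB0 : 0 < A + B by exact: addr_gt0.
apply: (@le_trans _ _ ((A + B) / A * sqsum x n + (A + B) / B * sqsum y n)).
  rewrite /sqsum !seriesEnat /= !mulr_sumr -big_split /=; apply: ler_sum => i _.
  set a := normc (x i); set b := normc (y i).
  apply: (@le_trans _ _ ((a + b) ^+ 2)).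
    by rewrite lerXn2r ?nnegrE ?normc_ge0 ?addr_ge0 ?normc_ge0// le_normc_add.
  rewrite -subr_ge0.
  have -> : (A + B) / A * a ^+ 2 + (A + B) / B * b ^+ 2 - (a + b) ^+ 2 =
            (B * a - A * b) ^+ 2 / (A * B).
    by field; rewrite !gt_eqF.
  by rewrite divr_ge0 ?sqr_ge0// mulr_ge0 ?(ltW A0) ?(ltW B0).
have -> : (A + B) ^+ 2 = (A + B) / A * A ^+ 2 + (A + B) / B * B ^+ 2.
  by field; rewrite !gt_eqF.
by apply: lerD; apply: ler_wpM2l; rewrite // divr_ge0 ?ltW.
Qed.

Lemma sqsum0 : sqsum 0 = cst 0.
Proof.
apply/funext => n; rewrite /sqsum seriesEnat /= big1// => i _.
by rewrite /= expr0n /= addr0 sqrtr0 expr0n.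
Qed.

Lemma sqsumZ (c : R[i]) x n : sqsum (c *: x) n = normc c ^+ 2 * sqsum x n.
Proof.
rewrite /sqsum !seriesEnat /= mulr_sumr; apply: eq_bigr => i _.
by rewrite -exprMn -normcM.
Qed.

Lemma square_summable_submod : submod_closed square_summable.
Proof.
split.
  by apply/square_summableP; rewrite sqsum0; exact: is_cvg_cst.
move=> c x y /square_summableP cx /square_summableP cy.
apply/square_summableP.
pose A := 1 + normc c ^+ 2 * limn (sqsum x); pose B := 1 + limn (sqsum y).
have A1 : 1 <= A by rewrite lerDl mulr_ge0 ?sqr_ge0// lim_sqsum_ge0.
have B1 : 1 <= B by rewrite lerDl lim_sqsum_ge0.
have le_sq (C : R) : 1 <= C -> C <= C ^+ 2 by move=> C1; rewrite ler_eXnr.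
apply: (@cvg_sqsum_bound _ ((A + B) ^+ 2)); apply: sqsumD_le => [||n|n].
- exact: lt_le_trans A1.
- exact: lt_le_trans B1.
- rewrite sqsumZ; apply: le_trans (le_sq _ A1).
  by rewrite ler_wpDl// ler_wpM2l ?sqr_ge0// sqsum_le_lim.
- by apply: le_trans (le_sq _ B1); rewrite ler_wpDl// sqsum_le_lim.
Qed.

HB.instance Definition _ :=
  GRing.isSubmodClosed.Build R[i] (nat -> R[i]) square_summable
    square_summable_submod.

End square_summable.

Lemma real_complex_cvg (R : realType) (u : R^nat) (l : R) :
  u @ \oo --> l -> (fun n => (u n)%:C%C) @ \oo --> l%:C%C.
Proof.
move=> ul; apply/cvgrPdist_lt => -[a b]; rewrite ltcE /= => /andP[/eqP -> a0].
have /cvgrPdist_lt/(_ a a0) := ul.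
apply: filterS => n h; rewrite -rmorphB normc_def /= expr0n /= addr0 sqrtr_sqr.
by rewrite ltcR.
Qed.

Lemma initial_cvgP (S : choiceType) (V : topologicalType) (f : S -> V)
    (F : set_system S) (s : S) : Filter F ->
  F --> (s : initial_topology f) <-> f @ F --> f s.
Proof.
move=> FF; split=> [Fs|Ffs].
  by apply: cvg_trans (@initial_continuous _ _ f s); exact: cvg_app.
move=> A; rewrite /= nbhsE => -[B [[C oC <-] Cs]] BA.
by apply: filterS BA _; apply: Ffs; exact: open_nbhs_nbhs.
Qed.

Lemma ptws_cvgP (S U : Type) (V : topologicalType) (g : S -> U -> V)
    (F : set_system S) (f : U -> V) : Filter F ->
  (fun s => g s : {ptws U -> V}) @ F --> (f : {ptws U -> V}) <->
  forall u, (fun s => g s u) @ F --> f u.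
Proof.
move=> FF; rewrite cvg_sup; split=> H u.
  by have /initial_cvgP := H u; apply.
by apply/initial_cvgP; exact: H.
Qed.

Section ell2.
Variable R : realType.

Record ell2 := Ell2 {
  ell2_seq :> nat -> R[i];
  ell2_summable : ell2_seq \in @square_summable R }.

HB.instance Definition _ := [isSub for ell2_seq].
HB.instance Definition _ := [Choice of ell2 by <:].
HB.instance Definition _ := [SubChoice_isSubLmodule of ell2 by <:].

Definition l2norm (x : ell2) : R := Num.sqrt (limn (sqsum x)).

Lemma cvg_sqsum (x : ell2) : cvgn (sqsum x).
Proof. by apply/square_summableP; exact: ell2_summable. Qed.
Arguments cvg_sqsum : clear implicits.

Lemma l2norm_ge0 (x : ell2) : 0 <= l2norm x.
Proof. exact: sqrtr_ge0. Qed.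

Lemma sqr_l2norm (x : ell2) : l2norm x ^+ 2 = limn (sqsum x).
Proof. by rewrite sqr_sqrtr// lim_sqsum_ge0//; exact: cvg_sqsum. Qed.

Lemma ell2_addE (x y : ell2) : (x + y : ell2) = (x : nat -> R[i]) + y :> (nat -> R[i]).
Proof. by []. Qed.

Lemma ell2_scaleE (c : R[i]) (x : ell2) :
  (c *: x : ell2) = c *: (x : nat -> R[i]) :> (nat -> R[i]).
Proof. by []. Qed.

Lemma l2normD (x y : ell2) : l2norm (x + y) <= l2norm x + l2norm y.
Proof.
apply/ler_addgt0Pr => e e0.
have e20 : 0 < e / 2 by rewrite divr_gt0.
have sq_le (z : ell2) n : sqsum z n <= (l2norm z + e / 2) ^+ 2.
  apply: le_trans (sqsum_le_lim n (cvg_sqsum z)) _.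
  rewrite -sqr_l2norm lerXn2r ?nnegrE ?l2norm_ge0//; last by rewrite lerDl ltW.
  by rewrite addr_ge0 ?l2norm_ge0 ?(ltW e20).
have pos (z : ell2) : 0 < l2norm z + e / 2 by rewrite ltr_wpDl ?l2norm_ge0.
have -> : l2norm x + l2norm y + e = (l2norm x + e / 2) + (l2norm y + e / 2) by field.
have AB0 := ltW (addr_gt0 (pos x) (pos y)).
rewrite -(@ler_pXn2r _ 2)// ?nnegrE ?l2norm_ge0//.
rewrite sqr_l2norm; apply: lim_sqsum_le => n.
by rewrite ell2_addE; exact: sqsumD_le.
Qed.

Lemma l2normZ (c : R[i]) (x : ell2) : l2norm (c *: x) = normc c * l2norm x.
Proof.
have -> : normc c * l2norm x = Num.sqrt (normc c ^+ 2 * limn (sqsum x)).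
  by rewrite sqrtrM ?sqr_ge0// sqrtr_sqr ger0_norm ?normc_ge0.
congr Num.sqrt; apply/cvg_lim => //.
have -> : sqsum (c *: x : ell2) = (fun n => normc c ^+ 2 * sqsum x n).
  by apply/funext => n; rewrite ell2_scaleE sqsumZ.
by apply: cvgMl_tmp; exact: cvg_sqsum.
Qed.

Lemma l2norm_eq0 (x : ell2) : l2norm x = 0 -> x = 0.
Proof.
move=> x0; apply: val_inj; apply/funext => n /=.
apply: eq0_normc; apply/eqP; rewrite -sqrf_eq0 eq_le sqr_ge0 andbT.
apply: le_trans (sqsum_term_le n (cvg_sqsum x)) _.
by rewrite -sqr_l2norm x0 expr0n.
Qed.

Let l2normC (x : ell2) : R[i] := (l2norm x)%:C%C.

Let l2normC_D (x y : ell2) : l2normC (x + y) <= l2normC x + l2normC y.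
Proof. by rewrite /l2normC -rmorphD lecR l2normD. Qed.

Let l2normC_Z (c : R[i]) (x : ell2) : l2normC (c *: x) = `|c| * l2normC x.
Proof. by rewrite /l2normC l2normZ rmorphM. Qed.

Let l2normC_eq0 (x : ell2) : l2normC x = 0 -> x = 0.
Proof. by move=> /eqP; rewrite /l2normC fmorph_eq0 => /eqP; exact: l2norm_eq0. Qed.

HB.instance Definition _ :=
  Lmodule_isNormed.Build R[i] ell2 l2normC_D l2normC_Z l2normC_eq0.

Lemma ell2_normE (x : ell2) : `|x| = (l2norm x)%:C%C.
Proof. by []. Qed.

Definition inner (y x : ell2) : R[i] := limn (series (fun n => (y n)^* * x n)).

Lemma is_cvg_inner (y x : ell2) : cvgn (series (fun n => (y n)^* * x n)).
Proof.
set z := fun n => _.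
have zle n : normc (z n) <= normc (y n) ^+ 2 + normc (x n) ^+ 2.
  have -> : normc (z n) = normc (y n) * normc (x n).
    rewrite /z normcM; congr (_ * _); case: (y n) => a b /=.
    by rewrite sqrrN.
  rewrite -subr_ge0; set a := normc _; set b := normc _.
  have -> : a ^+ 2 + b ^+ 2 - a * b = ((a - b) ^+ 2 + (a ^+ 2 + b ^+ 2)) / 2 by field.
  by rewrite divr_ge0// !addr_ge0// sqr_ge0.
have cb (v : R^nat) : (forall n, `|v n| <= normc (z n)) -> cvgn (series v).
  move=> vz; apply: normed_cvg.
  apply: (@series_le_cvg _ _ (fun n => normc (y n) ^+ 2 + normc (x n) ^+ 2)).
  - by move=> n; exact: normr_ge0.
  - by move=> n; rewrite addr_ge0// sqr_ge0.
  - by move=> n; exact: le_trans (vz n) (zle n).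
  - rewrite (_ : series _ = sqsum y + sqsum x).
      by apply: is_cvgD; exact: cvg_sqsum.
    by apply/funext => n; rewrite /sqsum !seriesEnat /= big_split.
have /cvg_ex[/= a ca] : cvgn (series (fun n => complex.Re (z n))).
  apply: cb => n; case: (z n) => a b /=.
  by rewrite -sqrtr_sqr ler_sqrt ?addr_ge0 ?sqr_ge0// lerDl sqr_ge0.
have /cvg_ex[/= b cb'] : cvgn (series (fun n => complex.Im (z n))).
  apply: cb => n; case: (z n) => a' b /=.
  by rewrite -sqrtr_sqr ler_sqrt ?addr_ge0 ?sqr_ge0// lerDr sqr_ge0.
apply/cvg_ex; exists (a%:C%C + 'i%C * b%:C%C).
have -> : series z = (fun n => (series (fun n => complex.Re (z n)) n)%:C%C) \+
   (fun n => 'i%C * (series (fun n => complex.Im (z n)) n)%:C%C).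
  apply/funext => n /=; rewrite !seriesEnat /= !rmorph_sum /= mulr_sumr -big_split /=.
  by apply: eq_bigr => i _; exact: complexE.
apply: cvgD; first exact: real_complex_cvg.
by apply: cvgMl_tmp; exact: real_complex_cvg.
Qed.

Lemma delta_summable (k : nat) :
  (fun n => (n == k)%:R : R[i]) \in @square_summable R.
Proof.
apply/square_summableP; apply: (@cvg_sqsum_bound R _ 1) => n.
apply: (@le_trans _ _ (\sum_(0 <= i < n | i == k) 1)); last first.
  by rewrite big_nat1_eq; case: ifP.
rewrite /sqsum seriesEnat /= [leRHS]big_mkcond /=; apply: ler_sum => i _.
case: eqP => _ /=; first by rewrite expr1n expr0n /= addr0 sqrtr1 expr1n.
by rewrite expr0n /= addr0 sqrtr0 expr0n.
Qed.

Definition unit_vec (k : nat) : ell2 := Ell2 (delta_summable k).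

Lemma inner_unit_vec (k : nat) (x : ell2) : inner (unit_vec k) x = x k.
Proof.
apply/cvg_lim => //; apply: cvg_near_cst; exists k.+1 => // n /= kn.
rewrite seriesEnat /= (bigD1_seq k) ?iota_uniq ?mem_index_iota//=.
rewrite eqxx conjC1 mul1r big1 ?addr0// => i /negbTE ->.
by rewrite conjC0 mul0r.
Qed.

Definition Supp (u : ell2) : set nat := [set j | inner (unit_vec j) u != 0].

(* On R[i], [0 <= z] means that z is real and nonnegative. *)
Definition nonneg (x : ell2) : Prop := forall n, 0 <= x n.

(* The norm is an extended real, so that an unbounded operator has norm +oo
   rather than the default value of [sup]. *)
Definition opnorm (T : ell2 -> ell2) : \bar R :=
  ereal_sup [set (l2norm (T x))%:E | x in [set x | l2norm x <= 1]].

Definition bounded_operator (T : ell2 -> ell2) : Prop :=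
  linear T /\ (opnorm T < +oo)%E.

Definition positive_operator (T : ell2 -> ell2) : Prop :=
  bounded_operator T /\ forall x, nonneg x -> nonneg (T x).

Definition positive_contraction : set (ell2 -> ell2) :=
  [set T | positive_operator T /\ (opnorm T <= 1)%E].

Definition norming (S : ell2 -> ell2) (x : ell2) : Prop :=
  x != 0 /\ (l2norm (S x))%:E = (opnorm S * (l2norm x)%:E)%E.

Definition P1 : Type := set_type positive_contraction.
HB.instance Definition _ := Choice.on P1.

Definition op_of_P1 (T : P1) : ell2 -> ell2 := set_val T.
Coercion op_of_P1 : P1 >-> Funclass.

Definition P1_WOT : Type :=
  initial_topology
    (fun T : P1 => (fun yx => inner yx.1 (T yx.2)) : {ptws ell2 * ell2 -> R[i]}).
Definition P1_SOT : Type :=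
  initial_topology (fun T : P1 => (T : ell2 -> ell2) : {ptws ell2 -> ell2}).
HB.instance Definition _ := Topological.on P1_WOT.
HB.instance Definition _ := Topological.on P1_SOT.

Definition classM' : set P1 := [set T : P1 |
  opnorm T = 1%E /\
  exists (J : set nat) (u : nat -> ell2),
    (forall r, J r -> [/\ norming T (u r), nonneg (u r) & l2norm (u r) = 1]) /\
    \bigcup_(r in J) Supp (u r) = setT].

Lemma WOT_cvgP (F : set_system P1) (T : P1) : Filter F ->
  F --> (T : P1_WOT) <->
  forall y x, (fun S : P1 => inner y (S x)) @ F --> inner y (T x).
Proof.
move=> FF; rewrite initial_cvgP.
rewrite (ptws_cvgP (fun (S : P1) yx => inner yx.1 (S yx.2))).
by split=> [H y x|H [y x]]; [exact: (H (y, x))|exact: H].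
Qed.

Lemma SOT_cvgP (F : set_system P1) (T : P1) : Filter F ->
  F --> (T : P1_SOT) <->
  forall x, (fun S : P1 => l2norm (S x - T x)) @ F --> (0 : R).
Proof.
move=> FF; rewrite initial_cvgP (ptws_cvgP (fun (S : P1) x => S x)).
split=> H x.
  apply/cvgrPdist_lt => e e0.
  have /cvgrPdist_lt/(_ e%:C%C) := H x; rewrite ltcR => /(_ e0).
  by apply: filterS => S; rewrite distrC ell2_normE ltcR sub0r normrN ger0_norm ?l2norm_ge0.
apply/cvgrPdist_lt => e e0.
have [r r0 ->] : exists2 r : R, 0 < r & e = r%:C%C.
  case: e e0 => a b; rewrite ltcE /= => /andP[/eqP -> a0].
  by exists a.
have /cvgrPdist_lt/(_ r r0) := H x.
by apply: filterS => S; rewrite sub0r normrN ger0_norm ?l2norm_ge0// distrC ell2_normE ltcR.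
Qed.

End ell2.

Arguments P1 : clear implicits.
Arguments P1_WOT : clear implicits.
Arguments P1_SOT : clear implicits.

(* Main.v *)
Require Import Defs.
From mathcomp Require Import all_boot all_order all_algebra.
From mathcomp Require Import all_classical all_reals all_analysis.
From mathcomp Require Import complex ring lra.

(** Let S range over the positive contractions and tend weakly to T.

    If u is norming for T, so that |Tu| = |u|, then
    |Su - Tu|^2 = |Su|^2 + |Tu|^2 - 2 Re <Tu, Su> <= 2 |Tu|^2 - 2 Re <Tu, Su>,
    and the right-hand side tends to 0: thus Su tends to Tu in norm
    ([cvg_norming]).

    Positivity transfers this to every basis vector e_k with k in the support
    of u. As u - u_k e_k >= 0, coordinatewise 0 <= u_k S e_k <= S u
    ([positive_domination]). The vectors S e_k converge to T e_k coordinate by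
    coordinate and are dominated by the norm-convergent vectors u_k^-1 S u, so
    they converge in norm ([dominated_cvg], [cvg_unit_vec_Supp]).

    Since the supports of the norming vectors cover all indices, S e_k tends to
    T e_k for every k, and because the operators are contractions and the e_k
    span a dense subspace, S x tends to T x for every x
    ([cvg_of_cvg_unit_vec]). *)

Set Implicit Arguments.
Unset Strict Implicit.
Unset Printing Implicit Defensive.

Import Order.TTheory GRing.Theory Num.Theory.
Import numFieldNormedType.Exports.
Import ComplexField.Normc.

Local Open Scope classical_set_scope.
Local Open Scope ring_scope.

(** * Modulus of complex numbers *)

Section complex_modulus.
Variable R : realType.
Implicit Types z w : R[i].

Lemma normr_normc z : `|z| = (normc z)%:C%C.
Proof. by case: z. Qed.

Lemma sqr_normcB z w :
  normc (z - w) ^+ 2 =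
  normc z ^+ 2 + normc w ^+ 2 - 2 * complex.Re (z^* * w).
Proof.
case: z w => a b [c d] /=.
by rewrite !sqr_sqrtr ?addr_ge0 ?sqr_ge0//; ring.
Qed.

Lemma sqr_normcB_le z w :
  normc (z - w) ^+ 2 <= 2 * normc z ^+ 2 + 2 * normc w ^+ 2.
Proof.
case: z w => a b [c d] /=; rewrite !sqr_sqrtr ?addr_ge0 ?sqr_ge0//.
rewrite -subr_ge0 (_ : _ - _ = (a + c) ^+ 2 + (b + d) ^+ 2); last by ring.
by rewrite addr_ge0 ?sqr_ge0.
Qed.

Lemma ler_normc z w : 0 <= z -> z <= w -> normc z <= normc w.
Proof.
move=> z0 zw; have w0 := le_trans z0 zw.
by rewrite -lecR -!normr_normc !ger0_norm.
Qed.

Lemma cvg_normcB (I : Type) (F : set_system I) (f : I -> R[i]) z :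
  Filter F -> f @ F --> z -> (fun i => normc (f i - z)) @ F --> (0 : R).
Proof.
move=> FF /cvgrPdist_lt fz; apply/cvgrPdist_lt => e e0.
have := fz e%:C%C; rewrite ltcR => /(_ e0); apply: filterS => i.
by rewrite distrC normr_normc ltcR sub0r normrN ger0_norm// normc_ge0.
Qed.

Lemma cvg_Re (I : Type) (F : set_system I) (f : I -> R[i]) z :
  Filter F -> f @ F --> z ->
  (fun i => complex.Re (f i)) @ F --> complex.Re z.
Proof.
move=> FF fz; apply/cvgrPdist_lt => e e0.
have /cvgrPdist_lt/(_ e e0) := cvg_normcB FF fz; apply: filterS => i.
rewrite sub0r normrN ger0_norm ?normc_ge0//; apply: le_lt_trans.
rewrite distrC; case: (f i) z {fz} => a b [c d] /=.
by rewrite -sqrtr_sqr ler_sqrt ?addr_ge0 ?sqr_ge0// lerDl sqr_ge0.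
Qed.

Lemma sqr_cvg0 (I : Type) (F : set_system I) (f : I -> R) :
  Filter F -> (forall i, 0 <= f i) -> (fun i => f i ^+ 2) @ F --> (0 : R) ->
  f @ F --> (0 : R).
Proof.
move=> FF f0 /cvgrPdist_lt f2; apply/cvgrPdist_lt => e e0.
have := f2 (e ^+ 2) (exprn_gt0 2 e0); apply: filterS => i.
rewrite !sub0r !normrN ger0_norm ?sqr_ge0// ger0_norm//.
by rewrite ltr_pXn2r// nnegrE// ltW.
Qed.

End complex_modulus.

(** * Polarization, expansion and dominated convergence in l2 *)

Section ell2_theory.
Variable R : realType.
Implicit Types x y : ell2 R.

Lemma sqsumS (x : nat -> R[i]) n :
  sqsum x n.+1 = sqsum x n + normc (x n) ^+ 2.
Proof. by rewrite /sqsum !seriesEnat /= big_nat_recr. Qed.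

Lemma coordD x y n : (x + y) n = x n + y n. Proof. by []. Qed.

Lemma coordB x y n : (x - y) n = x n - y n. Proof. by []. Qed.

Lemma coordZ (c : R[i]) x n : (c *: x) n = c * x n. Proof. by []. Qed.

Lemma l2norm0 : l2norm (0 : ell2 R) = 0.
Proof. by have := l2normZ 0 (0 : ell2 R); rewrite scale0r normc0 mul0r. Qed.

Lemma l2norm_distC x y : l2norm (x - y) = l2norm (y - x).
Proof. by rewrite -opprB -scaleN1r l2normZ normcN normc1 mul1r. Qed.

(** Polarization; the identity holds for each partial sum, hence in the limit. *)
Lemma sqr_l2normB x y :
  l2norm (x - y) ^+ 2 =
  l2norm x ^+ 2 + l2norm y ^+ 2 - 2 * complex.Re (inner x y).
Proof.
rewrite !sqr_l2norm; apply/cvg_lim => //.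
have -> : sqsum (x - y : ell2 R) = (fun n => sqsum x n + sqsum y n -
    2 * complex.Re (series (fun k => (x k)^* * y k) n)).
  apply/funext; elim=> [|n IH].
    by rewrite /sqsum !seriesEnat /= !big_geq//= mulr0 addr0 subr0.
  rewrite !sqsumS IH coordB sqr_normcB.
  rewrite !seriesEnat /= big_nat_recr//= raddfD /=; ring.
apply: cvgB; first by apply: cvgD; exact: cvg_sqsum.
by apply: cvgMl_tmp; apply: cvg_Re; exact: is_cvg_inner.
Qed.

Lemma cvg_sqsum_tail x :
  (fun n => limn (sqsum x) - sqsum x n) @ \oo --> (0 : R).
Proof.
rewrite -[X in _ --> X](subrr (limn (sqsum x))).
by apply: cvgB; [exact: cvg_cst|exact: cvg_sqsum].
Qed.

Definition partial_expansion x n : ell2 R := \sum_(k < n) x k *: unit_vec R k.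

Lemma partial_expansionE x n j :
  partial_expansion x n j = if (j < n)%N then x j else 0.
Proof.
rewrite /partial_expansion; elim: n => [|n IH]; first by rewrite big_ord0.
rewrite big_ord_recr coordD coordZ IH /= ltnS [in RHS]leq_eqVlt.
case: eqP => [->|_] /=; first by rewrite ltnn mulr1 add0r.
by rewrite mulr0 addr0.
Qed.

Lemma cvg_partial_expansion x :
  (fun n => l2norm (x - partial_expansion x n)) @ \oo --> (0 : R).
Proof.
(* The first n coordinates cancel, so only those in [n, m) contribute. *)
have sqE n m : sqsum (x - partial_expansion x n : ell2 R) m =
    sqsum x (maxn m n) - sqsum x n.
  elim: m => [|m IH]; first by rewrite max0n subrr /sqsum seriesEnat /= big_geq.
  rewrite sqsumS IH coordB partial_expansionE.
  case: (ltnP m n) => mn.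
    by rewrite (maxn_idPr mn) !subrr normc0 expr0n addr0.
  by rewrite (maxn_idPl (leqW mn)) sqsumS subr0 addrAC.
apply: sqr_cvg0 => [?|]; first exact: l2norm_ge0.
apply: (squeeze_cvgr _ (cvg_cst 0) (cvg_sqsum_tail x)).
apply: nearW => n; rewrite sqr_ge0 sqr_l2norm; apply: lim_sqsum_le => m.
by rewrite sqE lerD2r sqsum_le_lim//; exact: cvg_sqsum.
Qed.

(** The tail beyond N of a sequence with |z|^2 <= A |d|^2 + B |a|^2 costs the full
    norm of d but only the tail of a. In the application d is small as a whole,
    while a is a fixed vector, whose tail is small once N is large. *)
Lemma tail_sqsum_le (z d a : nat -> R[i]) (A B : R) N m :
  0 <= A -> 0 <= B -> cvgn (sqsum d) -> cvgn (sqsum a) ->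
  (forall n, normc (z n) ^+ 2 <= A * normc (d n) ^+ 2 + B * normc (a n) ^+ 2) ->
  sqsum z m <=
    sqsum z N + A * limn (sqsum d) + B * (limn (sqsum a) - sqsum a N).
Proof.
move=> A0 B0 cd ca zda.
have incr k : sqsum z (N + k)%N + B * sqsum a N <=
    sqsum z N + A * sqsum d (N + k)%N + B * sqsum a (N + k)%N.
  elim: k => [|k IH].
    by rewrite addn0 lerD2r lerDl mulr_ge0// sqsum_ge0.
  by rewrite addnS !sqsumS; have := zda (N + k)%N; lra.
apply: (@le_trans _ _ (sqsum z (N + m)%N)).
  by apply: nondecreasing_sqsum; exact: leq_addl.
have dl := ler_wpM2l A0 (sqsum_le_lim (N + m)%N cd).
have al := ler_wpM2l B0 (sqsum_le_lim (N + m)%N ca).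
by have := incr m; lra.
Qed.

Lemma cvg_sqsum_coord (I : Type) (F : set_system I) (f : I -> ell2 R) N :
  Filter F -> (forall n, (fun i => normc (f i n)) @ F --> (0 : R)) ->
  (fun i => sqsum (f i) N) @ F --> (0 : R).
Proof.
move=> FF f0; elim: N => [|N IH].
  rewrite (_ : (fun i => _) = cst 0); first exact: cvg_cst.
  by apply/funext => i; rewrite /sqsum seriesEnat /= big_geq.
rewrite (_ : (fun i => _) = (fun i => sqsum (f i) N + normc (f i N) * normc (f i N))); last first.
  by apply/funext => i; rewrite sqsumS.
have -> : (0 : R) = 0 + 0 * 0 by ring.
by apply: cvgD => //; apply: cvgM.
Qed.

(** Dominated convergence in l2, with a dominating vector that may itself vary as
    long as it converges in norm. Norm convergence of g makes the tails of f
    uniformly small, and on finitely many coordinates pointwise convergence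
    suffices. Sequential arguments are unavailable, since F is an arbitrary
    filter: the cut-off N is chosen from g0 alone. *)
Lemma dominated_cvg (I : Type) (F : set_system I) (f g : I -> ell2 R)
    (f0 g0 : ell2 R) (C : R) : Filter F ->
  (forall i n, normc (f i n) <= C * normc (g i n)) ->
  (forall n, normc (f0 n) <= C * normc (g0 n)) ->
  (forall n, (fun i => f i n) @ F --> f0 n) ->
  (fun i => l2norm (g i - g0)) @ F --> (0 : R) ->
  (fun i => l2norm (f i - f0)) @ F --> (0 : R).
Proof.
move=> FF fg fg0 ff0 gg0; apply: sqr_cvg0 => [i|]; first exact: l2norm_ge0.
(* |f - f0|^2 <= 2|f|^2 + 2|f0|^2 <= 2C^2 (|g|^2 + |g0|^2), and
   |g|^2 <= 2|g - g0|^2 + 2|g0|^2: hence the constants 4 and 6. *)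
have bnd i n : normc ((f i - f0) n) ^+ 2 <=
    (4 * C ^+ 2) * normc ((g i - g0) n) ^+ 2 + (6 * C ^+ 2) * normc (g0 n) ^+ 2.
  have sq (z w : R[i]) : normc z <= C * normc w ->
      normc z ^+ 2 <= C ^+ 2 * normc w ^+ 2.
    move=> zw; rewrite -exprMn lerXn2r ?nnegrE ?normc_ge0//.
    by apply: le_trans zw; exact: normc_ge0.
  apply: le_trans (sqr_normcB_le _ _) _.
  have h1 := sq _ _ (fg i n); have h2 := sq _ _ (fg0 n).
  have := sqr_normcB_le (g i n - g0 n) (- g0 n).
  rewrite opprK subrK normcN => /(ler_wpM2l (sqr_ge0 C)).
  rewrite coordB; lra.
have C0 := sqr_ge0 C.
apply/cvgrPdist_lt => e e0.
have : (fun N => 6 * C ^+ 2 * (limn (sqsum g0) - sqsum g0 N)) @ \oo --> (0 : R).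
  have -> : (0 : R) = 6 * C ^+ 2 * 0 by ring.
  by apply: cvgMl_tmp; exact: cvg_sqsum_tail.
move=> /cvgrPdist_lt/(_ (e / 2)); rewrite divr_gt0// => /(_ isT) [N _ /(_ N (leqnn N))].
rewrite /= sub0r normrN => /(le_lt_trans (ler_norm _)) tailN.
have : (fun i => sqsum (f i - f0 : ell2 R) N +
    4 * C ^+ 2 * (l2norm (g i - g0) * l2norm (g i - g0))) @ F --> (0 : R).
  have -> : (0 : R) = 0 + 4 * C ^+ 2 * (0 * 0) by ring.
  apply: cvgD; last by apply: cvgMl_tmp; apply: cvgM.
  by apply: cvg_sqsum_coord => n; apply: (cvg_normcB FF (ff0 n)).
move=> /cvgrPdist_lt/(_ (e / 2)); rewrite divr_gt0// => /(_ isT).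
apply: filterS => i; rewrite !sub0r !normrN => /(le_lt_trans (ler_norm _)) hi.
rewrite ger0_norm ?sqr_ge0// sqr_l2norm.
apply: (@le_lt_trans _ _ (sqsum (f i - f0 : ell2 R) N +
   4 * C ^+ 2 * limn (sqsum (g i - g0 : ell2 R)) +
   6 * C ^+ 2 * (limn (sqsum g0) - sqsum g0 N))); last first.
  by rewrite -sqr_l2norm expr2; lra.
apply: lim_sqsum_le => m.
by apply: tail_sqsum_le (bnd i); rewrite ?(mulr_ge0 _ C0)//; exact: cvg_sqsum.
Qed.

End ell2_theory.

(** * Strong convergence of positive contractions *)

Section positive_contractions.
Variable R : realType.
Implicit Types (S T : P1 R) (x u : ell2 R).

Lemma P1P S : positive_contraction (S : ell2 R -> ell2 R).
Proof. exact: set_valP. Qed.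

Lemma P1_linear S : linear S.
Proof. by have [[[]]] := P1P S. Qed.

Lemma P1D S x y : S (x + y) = S x + S y.
Proof. by have := P1_linear S 1 x y; rewrite !scale1r. Qed.

Lemma P1_0 S : S 0 = 0.
Proof. by apply: (@addrI _ (S 0)); rewrite -P1D !addr0. Qed.

Lemma P1Z S c x : S (c *: x) = c *: S x.
Proof. by have := P1_linear S c x 0; rewrite !addr0 P1_0 addr0. Qed.

Lemma P1B S x y : S (x - y) = S x - S y.
Proof. by rewrite -scaleN1r P1D P1Z scaleN1r. Qed.

Lemma P1_nonneg S x : nonneg x -> nonneg (S x).
Proof. by have [[_ +] _] := P1P S; exact. Qed.

Lemma P1_contraction S x : l2norm (S x) <= l2norm x.
Proof.
have [->|x0] := eqVneq x 0; first by rewrite P1_0.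
have nx : 0 < l2norm x.
  by rewrite lt_neqAle l2norm_ge0 andbT eq_sym; apply: contra_neq x0 => /l2norm_eq0.
have nV : normc ((l2norm x)^-1)%:C%C = (l2norm x)^-1.
  by rewrite /= expr0n /= addr0 sqrtr_sqr ger0_norm// invr_ge0 ltW.
have op1 : (opnorm S <= 1)%E by have [] := P1P S.
have : ((l2norm (S ((l2norm x)^-1%:C%C *: x)))%:E <= 1)%E.
  apply: le_trans op1; apply: ereal_sup_ubound => /=.
  exists ((l2norm x)^-1%:C%C *: x) => //=.
  by rewrite l2normZ nV mulVf// gt_eqF.
by rewrite lee_fin P1Z l2normZ nV mulrC ler_pdivrMr// mul1r.
Qed.

(** Apply S to u - u_k e_k >= 0. *)
Lemma positive_domination S u k n : nonneg u ->
  normc (u k) * normc (S (unit_vec R k) n) <= normc (S u n).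
Proof.
move=> u0; rewrite -normcM.
have e0 : nonneg (unit_vec R k) by move=> j /=; case: eqP.
apply: ler_normc; first by rewrite mulr_ge0 //; exact: P1_nonneg.
have : nonneg (S (u - u k *: unit_vec R k)).
  apply: P1_nonneg => j.
  rewrite coordB coordZ /=.
  by case: eqP => [->|_]; rewrite ?mulr1 ?subrr// mulr0 subr0.
by move=> /(_ n); rewrite P1B P1Z coordB coordZ subr_ge0.
Qed.

(** Density of the finite combinations of basis vectors, together with the
    uniform bound 1 on the norms of the operators. *)
Lemma cvg_of_cvg_unit_vec (F : set_system (P1 R)) T : Filter F ->
  (forall k, (fun S : P1 R => l2norm (S (unit_vec R k) - T (unit_vec R k))) @ F
     --> (0 : R)) ->
  forall x, (fun S : P1 R => l2norm (S x - T x)) @ F --> (0 : R).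
Proof.
move=> FF Fe x.
have Fp N : (fun S : P1 R => l2norm (S (partial_expansion x N) -
    T (partial_expansion x N))) @ F --> (0 : R).
  elim: N => [|N IH].
    rewrite (_ : (fun S => _) = cst 0); first exact: cvg_cst.
    by apply/funext => S; rewrite /partial_expansion big_ord0 !P1_0 subrr l2norm0.
  have : (fun S : P1 R => l2norm (S (partial_expansion x N) -
      T (partial_expansion x N)) +
      normc (x N) * l2norm (S (unit_vec R N) - T (unit_vec R N))) @ F --> (0 : R).
    have -> : (0 : R) = 0 + normc (x N) * 0 by ring.
    by apply: cvgD => //; apply: cvgMl_tmp.
  apply: (squeeze_cvgr _ (cvg_cst 0)); apply: nearW => S.
  rewrite l2norm_ge0 /= /partial_expansion big_ord_recr !P1D !P1Z.
  by rewrite opprD addrACA -scalerBr -l2normZ l2normD.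
apply/cvgrPdist_lt => e e0.
have /cvgrPdist_lt/(_ (e / 4)) := cvg_partial_expansion x.
rewrite divr_gt0// => /(_ isT) [N _ /(_ N (leqnn N))].
rewrite /= sub0r normrN => /(le_lt_trans (ler_norm _)) xp.
set p := partial_expansion x N in xp.
have /cvgrPdist_lt/(_ (e / 4)) := Fp N.
rewrite divr_gt0// => /(_ isT); apply: filterS => S.
rewrite !sub0r !normrN => /(le_lt_trans (ler_norm _)) Sp.
rewrite ger0_norm ?l2norm_ge0//.
have -> : S x - T x = S (x - p) + ((S p - T p) + T (p - x)).
  by rewrite !P1B [S p - T p + _]addrA subrK addrA subrK.
have := l2normD (S (x - p)) ((S p - T p) + T (p - x)).
have := l2normD (S p - T p) (T (p - x)).
have := P1_contraction S (x - p).
have := P1_contraction T (p - x).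
by rewrite (l2norm_distC p x); lra.
Qed.

(** S u is no longer than T u, since S is a contraction and T preserves the norm
    of u. In Hilbert space, weak convergence of vectors whose norms do
    not exceed that of the limit is norm convergence. *)
Lemma cvg_norming (F : set_system (P1 R)) T u : Filter F ->
  l2norm (T u) = l2norm u ->
  (fun S : P1 R => inner (T u) (S u)) @ F --> inner (T u) (T u) ->
  (fun S : P1 R => l2norm (S u - T u)) @ F --> (0 : R).
Proof.
move=> FF Tu /(cvg_Re FF) FRe.
apply: sqr_cvg0 => [S|]; first exact: l2norm_ge0.
have : (fun S : P1 R => 2 * l2norm (T u) ^+ 2 -
    2 * complex.Re (inner (T u) (S u))) @ F --> (0 : R).
  have -> : (0 : R) = 2 * l2norm (T u) ^+ 2 - 2 * complex.Re (inner (T u) (T u)).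
    have := sqr_l2normB (T u) (T u); rewrite subrr l2norm0 expr0n /=; lra.
  by apply: cvgB; [exact: cvg_cst|exact: cvgMl_tmp].
apply: (squeeze_cvgr _ (cvg_cst 0)); apply: nearW => S.
rewrite sqr_ge0 /= l2norm_distC sqr_l2normB.
have : l2norm (S u) ^+ 2 <= l2norm (T u) ^+ 2.
  by rewrite Tu lerXn2r ?nnegrE ?l2norm_ge0// P1_contraction.
lra.
Qed.

(** Here positivity enters: S e_k is dominated by u_k^-1 S u, which converges in
    norm. *)
Lemma cvg_unit_vec_Supp (F : set_system (P1 R)) T u k : Filter F ->
  nonneg u -> Supp u k ->
  (fun S : P1 R => l2norm (S u - T u)) @ F --> (0 : R) ->
  (forall n, (fun S : P1 R => S (unit_vec R k) n) @ F --> T (unit_vec R k) n) ->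
  (fun S : P1 R => l2norm (S (unit_vec R k) - T (unit_vec R k))) @ F --> (0 : R).
Proof.
move=> FF u0; rewrite /Supp /= inner_unit_vec => uk FSu Fcoord.
have uk0 : 0 < normc (u k).
  rewrite lt_neqAle normc_ge0 andbT eq_sym.
  by apply: contra_neq uk => /eq0_normc.
have dom S n : normc (S (unit_vec R k) n) <= (normc (u k))^-1 * normc (S u n).
  by rewrite mulrC ler_pdivlMr// mulrC; exact: positive_domination.
exact: (@dominated_cvg _ _ _ (fun S : P1 R => S (unit_vec R k)) (fun S : P1 R => S u)
  _ (T u) (normc (u k))^-1).
Qed.

End positive_contractions.

(** * Weak-to-strong continuity at operators with enough norming vectors *)

Theorem theorem1p9 (R : realType) (T : P1 R) :
  classM' T -> {for (T : P1_WOT R), continuous (id : P1_WOT R -> P1_SOT R)}.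
Proof.
move=> [T1 [J [u [Ju UJ]]]].
pose F : set_system (P1 R) := nbhs (T : P1_WOT R).
have FF : Filter F by exact: (@nbhs_filter (P1_WOT R)).
have weak : forall y x, (fun S : P1 R => inner y (S x)) @ F --> inner y (T x).
  exact/WOT_cvgP.
(* Both topologies live on the same type: continuity at T says that the weak
   neighbourhood filter converges strongly. *)
suff : F --> (T : P1_SOT R) by [].
apply/SOT_cvgP; apply: cvg_of_cvg_unit_vec => k.
have [r Jr rk] : (\bigcup_(r in J) Supp (u r)) k by rewrite UJ.
have [[_ Tur] ur0 ur1] := Ju r Jr.
apply: (cvg_unit_vec_Supp FF ur0 rk).
  apply: cvg_norming (weak _ _).
  by move: Tur; rewrite T1 mul1e => -[].
(* The n-th coordinate is the inner product with the n-th basis vector. *)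
move=> n; rewrite -(inner_unit_vec n (T _)).
rewrite (_ : (fun S => _) =
  (fun S : P1 R => inner (unit_vec R n) (S (unit_vec R k)))); first exact: weak.
by apply/funext => S; rewrite inner_unit_vec.
Qed.
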